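(* Let $\mathsf{S}(\mathbf{x})_i=\exp(x_i)/\sum_{j=1}^n\exp(x_j)$ be the softmax function. Let $\mathbf{x}\in\mathbb{R}^n$ satisfy $x_1=\max_{1\le i\le n}x_i$, and let $$\Omega=\Big\{1\le i\le n:\exp(x_i-x_1)<\frac{\mathsf{u}_w}{2}\,\frac{1-\mathsf{u}_w}{1+\mathsf{u}_w}\Big\}.$$ The value of $\mathbf{s}=\mathsf{S}(\mathbf{x})$ computed in floating-point arithmetic by the unshifted algorithm with recursive summation satisfies (entrywise) $$|\mathsf{fl}(\mathbf{s})-\mathbf{s}|\le\Big((n-|\Omega|+2)\mathsf{u}_w+\sum_{i\in\Omega}s_i+\mathcal{O}(\mathsf{u}_w^2)\Big)\mathbf{s}.$$
   Context: Floating-point arithmetic: a base-2 floating-point number system with $\mu$ mantissa bits and unit round-off $\mathsf{u}_w=2^{-\mu-1}$, rounding to nearest; overflow and underflow are not taken into account. Every arithmetic operation ($+,-,\times,/$) and $\exp$ is correctly rounded: the computed value is the exact value rounded to nearest, so it equals the exact value times $1+\delta$, $|\delta|\le\mathsf{u}_w$. Unshifted algorithm with recursive summation: compute $\mathsf{fl}(\exp x_k)$ for $k=1,\dots,n$; set $\hat p_0=0$ and $\hat p_k=\mathsf{fl}(\hat p_{k-1}+\mathsf{fl}(\exp x_k))$ for $k=1,\dots,n$ in this order; return $\mathsf{fl}(\mathbf{s})_k=\mathsf{fl}\big(\mathsf{fl}(\exp x_k)/\hat p_n\big)$. $\mathcal{O}(\mathsf{u}_w^2)$ is as $\mathsf{u}_w\to0$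 (constants may depend on $n$). *)

(* Defs.v *)
From mathcomp Require Import all_boot all_order all_algebra.
From mathcomp Require Import boolp classical_sets reals topology normedtype.
From mathcomp Require Import landau sequences exp.
Import Order.TTheory GRing.Theory Num.Theory.
Import numFieldNormedType.Exports.

Set Implicit Arguments.
Unset Strict Implicit.
Unset Printing Implicit Defensive.

Local Open Scope ring_scope.

Definition unit_roundoff (R : realType) (mu : nat) : R := 2 ^- mu.+1.

(* Normalized binary numbers m * 2 ^ e whose significand has mu bits after the
   leading one.  The exponent e is unbounded: no overflow, no underflow. *)
Definition is_float (R : realType) (mu : nat) (y : R) : Prop :=
  y = 0 \/
  exists (m e : int), (2 ^ mu <= `|m| < 2 ^ mu.+1)%N /\ y = m%:~R * 2 ^ e.

(* The tie-breaking rule is left arbitrary. *)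
Definition round_to_nearest (R : realType) (mu : nat) (fl : R -> R) : Prop :=
  forall y : R, is_float mu (fl y) /\
    forall z : R, is_float mu z -> `|fl y - y| <= `|z - y|.

Definition softmax (R : realType) (n : nat) (x : 'rV[R]_n) : 'rV[R]_n :=
  \row_i (expR (x 0 i) / \sum_j expR (x 0 j)).

(* Left-to-right summation, starting from 0 and rounding after each addition. *)
Definition fl_recursive_sum (R : realType) (fl : R -> R) (s : seq R) : R :=
  foldl (fun p y => fl (p + y)) 0 s.

(* The unshifted algorithm; enum 'I_n lists the indices in increasing order. *)
Definition fl_softmax (R : realType) (fl : R -> R) (n : nat) (x : 'rV[R]_n) :
    'rV[R]_n :=
  \row_i fl (fl (expR (x 0 i)) /
             fl_recursive_sum fl [seq fl (expR (x 0 k)) | k <- enum 'I_n]).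

Definition negligible_set (R : realType) (u : R) (n : nat) (x : 'rV[R]_n)
    (i1 : 'I_n) : {set 'I_n} :=
  [set i | expR (x 0 i - x 0 i1) < u / 2 * ((1 - u) / (1 + u))]%SET.

(* Main.v *)
(** The running sum never drops below its first term [fl (exp x_1)], which is
    the largest one.  The terms indexed by Omega are below half the gap between
    the running sum and the next float, hence are absorbed without any effect.
    The denominator is thus a rounded sum of [n - #|Omega|] terms, the first of
    which is added to 0 exactly: each term goes through at most [n - #|Omega|]
    roundings, counting that of [exp].  What was dropped is the fraction
    [sigma = \sum_(i in Omega) s_i] of the exact sum; [sigma <= n u], so
    [1 / (1 - sigma)] is [1 + sigma] up to second order. *)

Require Import Defs.
From mathcomp Require Import all_boot all_order all_algebra.
From mathcomp Require Import boolp classical_sets reals topology normedtype.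
From mathcomp Require Import landau sequences exp.
From mathcomp Require Import ring lra.
Import Order.TTheory GRing.Theory Num.Theory.
Import numFieldNormedType.Exports.

Local Open Scope classical_set_scope.
Local Open Scope ring_scope.

(** * Binary floats: binades, neighbours and gaps *)

Lemma binade_exists (R : realType) (y : R) :
  0 < y -> exists e : int, 2 ^ e <= y < 2 ^ (e + 1).
Proof.
move=> y0; have l2 : 0 < ln 2 :> R by rewrite ln_gt0 // ltr1n.
have exp2 (z : int) : 2 ^ z = expR (z%:~R * ln 2) :> R.
  by rewrite -powR_intmul ?ler0n // /powR pnatr_eq0.
exists (Num.floor (ln y / ln 2)).
rewrite !exp2 -{2 3}(lnK (x := y)) ?posrE // ler_expR ltr_expR.
by rewrite -ler_pdivlMr // -ltr_pdivrMr // floor_itv.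
Qed.

Lemma exp2z_gt0 (R : realType) (e : int) : 0 < 2 ^ e :> R.
Proof. by rewrite exprz_gt0 // ltr0n. Qed.

Lemma unit_roundoff_gt0 (R : realType) (mu : nat) : 0 < unit_roundoff R mu.
Proof. by rewrite /unit_roundoff invr_gt0 exprn_gt0 // ltr0n. Qed.

Lemma unit_roundoff_le_half (R : realType) (mu : nat) :
  unit_roundoff R mu <= 2^-1.
Proof.
rewrite /unit_roundoff lef_pV2 ?posrE ?exprn_gt0 ?ltr0n //.
by rewrite -[leLHS]expr1 ler_weXn2l // ler1n.
Qed.

(** The closed upper end covers the successor of the largest significand: [2 ^ mu.+1] is
    renormalised by raising the exponent. *)
Lemma is_float_natM (R : realType) (mu m : nat) (e : int) :
  (2 ^ mu <= m <= 2 ^ mu.+1)%N -> is_float mu (m%:R * 2 ^ e : R).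
Proof.
case/andP=> lem; rewrite leq_eqVlt => /predU1P[->|ltm]; last first.
  by right; exists (m%:Z), e; rewrite absz_nat lem.
right; exists (2 ^ mu)%N%:Z, (e + 1); rewrite absz_nat leqnn ltn_exp2l // ltnSn.
split=> //; rewrite -pmulrn expfzDr ?pnatr_eq0 // expnS natrM expr1z.
ring.
Qed.

Lemma pos_floatP (R : realType) (mu : nat) (p : R) : 0 < p -> is_float mu p ->
  exists (m : nat) (e : int),
    (2 ^ mu <= m < 2 ^ mu.+1)%N /\ p = m%:R * 2 ^ e.
Proof.
move=> p0 [p_0|[m [e [mE pE]]]]; first by rewrite p_0 ltxx in p0.
exists `|m|%N, e; split=> //; rewrite pE natr_absz ger0_norm //.
by move: p0; rewrite pE pmulr_lgt0 ?exp2z_gt0 // ltr0z => /ltW.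
Qed.

(** Division by [2 ^ (e' - mu)] sends the binade of [y] to [[2 ^ mu, 2 ^ mu.+1)], where the integer
    part is the significand. *)
Lemma float_bracket (R : realType) (mu : nat) (y : R) : 0 < y ->
  exists (m : nat) (e : int), (2 ^ mu <= m < 2 ^ mu.+1)%N /\
    m%:R * 2 ^ e <= y < m.+1%:R * 2 ^ e.
Proof.
move=> y0; have [e' /andP[le_y lt_y]] := binade_exists R y y0.
set e := e' - mu%:Z; have e0 := exp2z_gt0 R e.
have eE : 2 ^ e' = (2 ^ mu)%N%:R * 2 ^ e :> R.
  by rewrite natrX exprnP -expfzDr ?pnatr_eq0 // /e addrC subrK.
have eE1 : 2 ^ (e' + 1) = (2 ^ mu.+1)%N%:R * 2 ^ e :> R.
  by rewrite expfzDr ?pnatr_eq0 // eE expnS natrM expr1z; ring.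
set t := y / 2 ^ e; have t0 : 0 <= t by rewrite divr_ge0 ?ltW.
have /andP[t1 t2] := truncn_itv t0.
exists (Num.trunc t), e; split; last first.
  by rewrite -ler_pdivlMr // -ltr_pdivrMr // t1 t2.
apply/andP; split.
  by rewrite truncn_ge_nat // ler_pdivlMr // -eE.
by rewrite truncn_lt_nat // ltr_pdivrMr // -eE1.
Qed.

(** A float whose exponent is at least [e] is an integer multiple of [2 ^ e]; one with a smaller
    exponent stays below [2 ^ mu * 2 ^ e], hence below [m * 2 ^ e]. *)
Lemma float_gap (R : realType) (mu m : nat) (e : int) (q : R) :
  (2 ^ mu <= m)%N -> is_float mu q -> m%:R * 2 ^ e < q ->
  m.+1%:R * 2 ^ e <= q.
Proof.
move=> lem fq ltq; have e0 := exp2z_gt0 R e.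
have q0 : 0 < q by apply: le_lt_trans ltq; rewrite mulr_ge0 ?ler0n ?ltW.
have [m' [e' [/andP[_ ltm'] qE]]] := pos_floatP R mu q q0 fq.
have [lee|lte] := lerP e e'.
  have [k kE] : exists k : nat, e' = e + k%:Z.
    by exists `|e' - e|%N; rewrite gez0_abs ?subr_ge0 // subrKC.
  have qE' : q = (m' * 2 ^ k)%N%:R * 2 ^ e.
    by rewrite qE kE expfzDr ?pnatr_eq0 // natrM natrX exprnP; ring.
  by move: ltq; rewrite qE' ltr_pM2r // ltr_nat ler_pM2r // ler_nat.
suff: q <= m%:R * 2 ^ e by rewrite leNgt ltq.
rewrite qE; apply: (@le_trans _ _ ((2 ^ mu.+1)%N%:R * 2 ^ e')).
  by rewrite ler_pM2r ?exp2z_gt0 // ler_nat ltnW.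
apply: (@le_trans _ _ ((2 ^ mu)%N%:R * 2 ^ e)); last first.
  by rewrite ler_pM2r // ler_nat.
rewrite expnS mulnC natrM -mulrA ler_pM2l ?ltr0n ?expn_gt0 //.
have -> : 2%:R * 2 ^ e' = 2 ^ (e' + 1) :> R.
  by rewrite expfzDr ?pnatr_eq0 // expr1z mulrC.
by rewrite ler_weXz2l ?ler1n // lezD1.
Qed.

(** * Rounding to nearest: relative error, monotonicity of sums, absorption *)

(** The floats bracketing [y] are [2 ^ e] apart, so the nearer one is within [2 ^ e / 2 = u * (2 ^
    mu * 2 ^ e) <= u * y]. *)
Lemma round_to_nearest_relative (R : realType) (mu : nat) (fl : R -> R)
    (y : R) :
  round_to_nearest mu fl -> 0 < y -> `|fl y - y| <= unit_roundoff R mu * y.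
Proof.
move=> fl_nearest y0.
have [m [e [/andP[lem ltm] /andP[le_y lt_y]]]] := float_bracket R mu y y0.
have [_ fl_min] := fl_nearest y.
have e0 := exp2z_gt0 R e.
have fm : is_float mu (m%:R * 2 ^ e : R).
  by apply: is_float_natM; rewrite lem ltnW.
have fm1 : is_float mu (m.+1%:R * 2 ^ e : R).
  by apply: is_float_natM; rewrite ltm leqW.
have := fl_min _ fm; have := fl_min _ fm1.
rewrite (ger0_norm (x := m.+1%:R * _ - y)); last by rewrite subr_ge0 ltW.
move => n1.
rewrite (ler0_norm (x := m%:R * _ - y)); last by rewrite subr_le0.
move => n2.
have hu : 2 ^ e / 2 <= unit_roundoff R mu * y.
  apply: (@le_trans _ _ (unit_roundoff R mu * ((2 ^ mu)%N%:R * 2 ^ e))).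
    rewrite /unit_roundoff natrX exprS invfM -!mulrA (mulrA (_ ^- mu)).
    by rewrite mulVf ?mul1r 1?mulrC // expf_neq0 // pnatr_eq0.
  rewrite ler_pM2l ?unit_roundoff_gt0 //; apply: le_trans le_y.
  by rewrite ler_pM2r // ler_nat.
apply: le_trans hu; rewrite -natr1 mulrDl mul1r in n1.
lra.
Qed.

Lemma round_to_nearest_float (R : realType) (mu : nat) (fl : R -> R) (y : R) :
  round_to_nearest mu fl -> is_float mu y -> fl y = y.
Proof.
move=> fl_nearest fy; have [_ /(_ y fy)] := fl_nearest y.
by rewrite subrr normr0 normr_le0 subr_eq0 => /eqP.
Qed.

Lemma fl_addr_ge (R : realType) (mu : nat) (fl : R -> R) (p y : R) :
  round_to_nearest mu fl -> is_float mu p -> 0 <= y -> p <= fl (p + y).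
Proof.
move=> fl_nearest fp y0; have [_ /(_ p fp)] := fl_nearest (p + y).
rewrite opprD addNKr normrN (ger0_norm y0) ler_norml => /andP[+ _].
lra.
Qed.

(** As [p] is itself a candidate, the rounded sum lies in [[p, p + 2 y]], and
    [2 y < u * p <= 2 ^ e], the distance from [p] to the next float. *)
Lemma fl_absorb (R : realType) (mu : nat) (fl : R -> R) (p y : R) :
  round_to_nearest mu fl -> is_float mu p -> 0 < p -> 0 <= y ->
  y < unit_roundoff R mu / 2 * p -> fl (p + y) = p.
Proof.
move=> fl_nearest fp p0 y0 lty.
have lep : p <= fl (p + y) by apply: (fl_addr_ge R mu).
have [fq fl_min] := fl_nearest (p + y).
have := fl_min p fp; rewrite opprD addNKr normrN (ger0_norm y0) ler_norml.
case/andP=> _ leq; apply/eqP; rewrite eq_le lep andbT leNgt; apply/negP => ltq.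
have [m [e [/andP[lem ltm] pE]]] := pos_floatP R mu p p0 fp.
have e0 := exp2z_gt0 R e.
have gap : m.+1%:R * 2 ^ e <= fl (p + y).
  by apply: (float_gap R mu); rewrite // -pE.
have hu : unit_roundoff R mu * p <= 2 ^ e.
  rewrite pE mulrA ler_piMl ?ltW // /unit_roundoff mulrC ltr_pdivrMr ?mul1r.
    by rewrite -natrX ltr_nat.
  by rewrite exprn_gt0 // ltr0n.
move: gap; rewrite -natr1 mulrDl mul1r -pE.
lra.
Qed.

(** * Recursive summation with absorbed terms *)

(** Stated for an arbitrary running sum so that induction on [s] applies: [A] is the exact sum of
    the terms kept so far, [c] bounds the roundings met by each of them, and [b] is a floor under
    the running sum that keeps the terms in [N] absorbed. *)
Lemma fl_recursive_sum_bounds (R : realType) (mu : nat) (fl : R -> R)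
    (I : Type) (a : I -> R) (N : pred I) (b : R) (s : seq I)
    (p A : R) (c : nat) :
  let u := unit_roundoff R mu in
  round_to_nearest mu fl -> (forall i, 0 < a i) -> 0 < b ->
  (forall i, N i -> fl (a i) < u / 2 * b) ->
  is_float mu p -> b <= p -> 0 <= A -> (0 < c)%N ->
  (1 - u) ^+ c * A <= p <= (1 + u) ^+ c * A ->
  (1 - u) ^+ (c + count (predC N) s) * (A + \sum_(i <- s | ~~ N i) a i) <=
  foldl (fun p y => fl (p + y)) p [seq fl (a i) | i <- s] <=
  (1 + u) ^+ (c + count (predC N) s) * (A + \sum_(i <- s | ~~ N i) a i).
Proof.
move=> u fl_nearest a0 b0 negl.
have u0 : 0 < u := unit_roundoff_gt0 R mu.
have uh : u <= 2^-1 := unit_roundoff_le_half R mu.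
elim: s p A c => [|i s IHs] p A c fp bp A0 c0 bnd /=.
  by rewrite big_nil addr0 addn0.
have ai0 := a0 i; have /ler_normlP[fa1 fa2] :=
  round_to_nearest_relative R mu fl (a i) fl_nearest ai0.
rewrite -/u in fa1 fa2.
have fai0 : 0 < fl (a i) by nra.
have p0 : 0 < p := lt_le_trans b0 bp.
rewrite big_cons; case: ifPn => [nNi|/negbNE Ni]; last first.
  rewrite add0n (fl_absorb R mu fl p) // ?(ltW fai0) //; first exact: IHs.
  by apply: lt_le_trans (negl i Ni) _; rewrite ler_pM2l // divr_gt0.
have fp' : is_float mu (fl (p + fl (a i))).
  by have [] := fl_nearest (p + fl (a i)).
have lep := fl_addr_ge R mu fl p (fl (a i)) fl_nearest fp (ltW fai0).
have q0 : 0 < p + fl (a i) by rewrite addr_gt0.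
have /ler_normlP[fs1 fs2] :=
  round_to_nearest_relative R mu fl (p + fl (a i)) fl_nearest q0.
rewrite -/u in fs1 fs2.
rewrite addnA addrA; apply: IHs => //.
- exact: le_trans lep.
- by rewrite addr_ge0 // ltW.
- by rewrite addn1.
case/andP: bnd => bnd1 bnd2; rewrite addn1 !exprSr.
case: c c0 bnd1 bnd2 => // c _.
(* The incoming term has met only the rounding of [fl (a i)]; since the exponent is positive, the
   common powers cover it too. *)
have : (1 - u) ^+ c.+1 <= 1 - u.
  by rewrite exprS ler_piMr ?exprn_ile1; lra.
have : 1 + u <= (1 + u) ^+ c.+1.
  by rewrite exprS ler_peMr ?exprn_ege1; lra.
move: (_ ^+ _) => V; move: (_ ^+ _) => W hV hW bnd1 bnd2.
have l1 : W * (A + a i) <= p + fl (a i) by nra.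
have l2 : p + fl (a i) <= V * (A + a i) by nra.
by apply/andP; split; nra.
Qed.

(** * Second-order expansion of the relative error *)

(* [1 + u + 2 u^2] bounds both [1 + u] and [1 / (1 - u)] for [u <= 1 / 2]. *)
Lemma pow_second_order (R : realFieldType) (u : R) (m : nat) :
  0 <= u <= 1 -> (1 + u + 2 * u ^+ 2) ^+ m <= 1 + m%:R * u + 7 ^+ m * u ^+ 2.
Proof.
case/andP=> u0 u1; elim: m => [|m IHm]; first by rewrite !expr0; nra.
have m0 : 0 <= m%:R :> R := ler0n R m.
(* Why 7: with [M = m] and [K = 7 ^+ m], the terms of order two and more in the product total at
   most [(4 K + 3 M + 2) u^2], and [M + 1 <= K] makes this at most [7 K u^2]. *)
have mK : m%:R + 1 <= 7 ^+ m :> R.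
  by rewrite natr1 -natrX ler_nat ltn_expl.
rewrite (exprSr _ m) (exprSr 7 m) -[m.+1%:R]natr1.
apply: (@le_trans _ _ ((1 + m%:R * u + 7 ^+ m * u ^+ 2) *
    (1 + u + 2 * u ^+ 2))).
  by rewrite ler_wpM2r //; nra.
move: (7 ^+ m) (m%:R) m0 mK => K M M0 MK.
have u20 : 0 <= u ^+ 2 by rewrite exprn_ge0.
have u3 : u ^+ 3 <= u ^+ 2 by rewrite exprSr; nra.
have u4 : u ^+ 4 <= u ^+ 2 by rewrite -[4%N]/(2 + 2)%N exprD; nra.
have u2K : M * u ^+ 2 + u ^+ 2 <= K * u ^+ 2 by nra.
have u3K : (K + 2 * M) * u ^+ 3 <= (K + 2 * M) * u ^+ 2.
  by apply: ler_wpM2l => //; nra.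
have u4K : 2 * K * u ^+ 4 <= 2 * K * u ^+ 2 by apply: ler_wpM2l => //; nra.
have -> : (1 + M * u + K * u ^+ 2) * (1 + u + 2 * u ^+ 2) =
  1 + (M + 1) * u + (M + 2 + K) * u ^+ 2 + (K + 2 * M) * u ^+ 3 +
  2 * K * u ^+ 4 by ring.
lra.
Qed.

(* Generous: it collects the coefficients of [u ^+ 2] and of the higher powers
   in the product of the bounds on [(1 - u)^-(m + 2)] and [(1 - sigma)^-1]. *)
Definition second_order_coef (R : realType) (n : nat) : R :=
  7 ^+ n.+2 * (1 + n%:R + n%:R ^+ 3) + (n%:R + 2) * (n%:R + n%:R ^+ 3) +
  n%:R ^+ 3.

(** Division-free bound on [(1 + u)^2 / ((1 - u)^m (1 - sigma))]: the numerator stands for the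
    roundings of [exp] and of the quotient, the denominator for the computed sum relative to the
    exact one. *)
Lemma relative_error_second_order (R : realType) (n m : nat) (u sigma : R) :
  0 <= u <= 2^-1 -> (m <= n)%N -> 0 <= sigma -> sigma <= n%:R * u ->
  1 <= n%:R * (1 - sigma) ->
  (1 + u) ^+ 2 <= (1 + (m%:R + 2) * u + sigma + second_order_coef R n * u ^+ 2)
    * ((1 - u) ^+ m * (1 - sigma)).
Proof.
case/andP=> u0 uh mn s0 sn ns.
have n0 : 0 <= n%:R :> R := ler0n R n.
have m0 : 0 <= m%:R :> R := ler0n R m.
have mnR : m%:R <= n%:R :> R by rewrite ler_nat.
have s1 : 0 < 1 - sigma by nra.
(* [1 / (1 - sigma) = 1 + sigma + sigma^2 / (1 - sigma)], where [sigma^2 <= n^2 u^2] and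
   [1 / (1 - sigma) <= n]; hence the cube. *)
have hs : 1 <= (1 + sigma + n%:R ^+ 3 * u ^+ 2) * (1 - sigma).
  have : sigma ^+ 2 <= (n%:R * u) ^+ 2 by rewrite !expr2 ler_pM.
  have : (n%:R * u) ^+ 2 <= (n%:R * u) ^+ 2 * (n%:R * (1 - sigma)).
    by rewrite ler_peMr // sqr_ge0.
  have -> : (1 + sigma + n%:R ^+ 3 * u ^+ 2) * (1 - sigma) =
    1 - sigma ^+ 2 + (n%:R * u) ^+ 2 * (n%:R * (1 - sigma)) by ring.
  lra.
set v := 1 + u + 2 * u ^+ 2.
have v1 : 1 + u <= v by rewrite /v; nra.
have hv : 1 <= v * (1 - u).
  have : 0 <= u ^+ 2 * (1 - 2 * u) by apply: mulr_ge0; nra.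
  by rewrite /v; lra.
(* Of the [m + 2] factors [v], [m] compensate the factors [1 - u] and two dominate [(1 + u)^2]. *)
have hm : (1 + u) ^+ 2 <= v ^+ m.+2 * (1 - u) ^+ m.
  rewrite -(addn2 m) exprD mulrAC -exprMn; apply: (@le_trans _ _ (v ^+ 2)).
    by rewrite lerXn2r ?nnegrE; lra.
  by rewrite ler_peMl ?sqr_ge0 // exprn_ege1.
have u01 : 0 <= u <= 1 by apply/andP; split; lra.
have hp := pow_second_order R u m.+2 u01; rewrite -/v in hp.
have K0 : 0 <= 7 ^+ m.+2 :> R by rewrite exprn_ge0.
have KK : 7 ^+ m.+2 <= 7 ^+ n.+2 :> R.
  by rewrite ler_weXn2l ?ler1n // !ltnS.
set L := n%:R ^+ 3 : R; have L0 : 0 <= L by rewrite exprn_ge0.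
have hC : v ^+ m.+2 * (1 + sigma + L * u ^+ 2) <=
    1 + (m%:R + 2) * u + sigma + second_order_coef R n * u ^+ 2.
  have u20 : 0 <= u ^+ 2 by rewrite exprn_ge0.
  apply: (@le_trans _ _ ((1 + (m%:R + 2) * u + 7 ^+ n.+2 * u ^+ 2) *
      (1 + sigma + L * u ^+ 2))).
    rewrite ler_wpM2r //; first by rewrite !addr_ge0 ?mulr_ge0.
    apply: le_trans hp _; rewrite -addn2 natrD lerD2l.
    by rewrite ler_wpM2r // addn2.
  rewrite /second_order_coef -/L.
  move: (7 ^+ n.+2 : R) (le_trans K0 KK) => K K0'.
  set M : R := m%:R + 2; have M0 : 0 <= M by rewrite /M; lra.
  have MN : M <= n%:R + 2 by rewrite /M; lra.
  have t1 : M * u * sigma <= (n%:R + 2) * n%:R * u ^+ 2.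
    have -> : (n%:R + 2) * n%:R * u ^+ 2 = ((n%:R + 2) * u) * (n%:R * u).
      by ring.
    by rewrite ler_pM ?mulr_ge0 // ler_wpM2r.
  have t2 : M * u * (L * u ^+ 2) <= (n%:R + 2) * (L * u ^+ 2).
    by rewrite ler_wpM2r ?mulr_ge0 //; nra.
  have t3 : K * u ^+ 2 * sigma <= K * u ^+ 2 * n%:R.
    by rewrite ler_wpM2l ?mulr_ge0 //; nra.
  have t4 : K * u ^+ 2 * (L * u ^+ 2) <= K * u ^+ 2 * L.
    by rewrite ler_wpM2l ?mulr_ge0 // ler_piMr // exprn_ile1 //; lra.
  have -> : (1 + M * u + K * u ^+ 2) * (1 + sigma + L * u ^+ 2) =
    1 + M * u + sigma + L * u ^+ 2 + K * u ^+ 2 + M * u * sigma +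
    M * u * (L * u ^+ 2) + K * u ^+ 2 * sigma + K * u ^+ 2 * (L * u ^+ 2).
    by ring.
  lra.
have P0 : 0 <= (1 - u) ^+ m by rewrite exprn_ge0 //; lra.
apply: (le_trans hm).
apply: (@le_trans _ _ (v ^+ m.+2 * (1 + sigma + L * u ^+ 2) *
    ((1 - u) ^+ m * (1 - sigma)))).
  rewrite mulrACA ler_peMr // mulr_ge0 ?exprn_ge0 // /v; nra.
by rewrite ler_wpM2r // mulr_ge0 // ltW.
Qed.

(** * The softmax denominator and the final error bound *)

Lemma notin_negligible_set (R : realType) (mu n : nat) (x : 'rV[R]_n)
    (i : 'I_n) : i \notin negligible_set (unit_roundoff R mu) x i.
Proof.
have u0 := unit_roundoff_gt0 R mu; have uh := unit_roundoff_le_half R mu.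
rewrite inE subrr expR0 -leNgt mulrA ler_pdivrMr; last lra.
by rewrite mul1r; nra.
Qed.

Lemma fl_recursive_sum_softmax (R : realType) (n : nat) (hn : (0 < n)%N)
    (mu : nat) (fl : R -> R) (x : 'rV[R]_n) :
  let u := unit_roundoff R mu in
  let Omega := negligible_set u x (Ordinal hn) in
  round_to_nearest mu fl ->
  (1 - u) ^+ #|~: Omega| * \sum_(i | i \notin Omega) expR (x 0 i) <=
  fl_recursive_sum fl [seq fl (expR (x 0 k)) | k <- enum 'I_n] <=
  (1 + u) ^+ #|~: Omega| * \sum_(i | i \notin Omega) expR (x 0 i).
Proof.
case: n hn x => [[]|n hn x u Omega fl_nearest]; first by [].
have i1E : Ordinal hn = ord0 by apply: val_inj.
have u0 : 0 < u := unit_roundoff_gt0 R mu.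
have uh : u <= 2^-1 := unit_roundoff_le_half R mu.
have nOm0 : ord0 \notin Omega by rewrite -i1E notin_negligible_set.
have rel i := round_to_nearest_relative R mu fl (expR (x 0 i)) fl_nearest
  (expR_gt0 (x 0 i)).
have flge i : (1 - u) * expR (x 0 i) <= fl (expR (x 0 i)).
  by have /ler_normlP[+ _] := rel i; rewrite -/u; lra.
have flle i : fl (expR (x 0 i)) <= (1 + u) * expR (x 0 i).
  by have /ler_normlP[_ +] := rel i; rewrite -/u; lra.
have fl0 i : 0 < fl (expR (x 0 i)).
  by apply: lt_le_trans (flge i); rewrite mulr_gt0 ?expR_gt0 // subr_gt0; lra.
(* The factor [(1 - u) / (1 + u)] in the threshold pays for rounding both exponentials, so the
   comparison survives between computed values. *)
have negl i : i \in Omega -> fl (expR (x 0 i)) < u / 2 * fl (expR (x 0 ord0)).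
  rewrite inE i1E expRD expRN -/u ltr_pdivrMr ?expR_gt0 // => lti.
  apply: le_lt_trans (flle i) _.
  apply: (@lt_le_trans _ _ (u / 2 * ((1 - u) * expR (x 0 ord0)))).
    move: lti; rewrite mulrA mulrAC mulrA ltr_pdivlMr; last lra.
    by rewrite -!mulrA (mulrC (1 - u)); lra.
  by rewrite ler_pM2l // divr_gt0.
have float0 : is_float mu (fl (expR (x 0 ord0))).
  by have [] := fl_nearest (expR (x 0 ord0)).
(* The induction starts after the first term with [c = 1]: adding it to 0 is exact, so only its
   [exp] was rounded. *)
have := fl_recursive_sum_bounds R mu fl _ (fun i => expR (x 0 i))
  [in Omega] _ (map (lift ord0) (enum 'I_n)) _ (expR (x 0 ord0)) 1
  fl_nearest (fun i => expR_gt0 _) (fl0 ord0) negl float0 (lexx _)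
  (expR_ge0 _) isT.
rewrite !expr1 flge flle -/u => /(_ isT).
have -> : (1 + count (predC [in Omega]) [seq lift ord0 i | i <- enum 'I_n])%N
    = #|~: Omega|.
  have -> : #|~: Omega| = (\sum_(i <- enum 'I_n.+1 | i \notin Omega) 1)%N.
    by rewrite big_enum_cond -sum1_card; apply: eq_bigl => i; rewrite inE.
  by rewrite enum_ordSl big_cons nOm0 sum1_count.
have <- : \sum_(i <- enum 'I_n.+1 | i \notin Omega) expR (x 0 i) =
    \sum_(i | i \notin Omega) expR (x 0 i) by rewrite big_enum_cond.
rewrite /fl_recursive_sum enum_ordSl big_cons nOm0 /= add0r.
rewrite (round_to_nearest_float R mu fl _ fl_nearest float0).
exact: id.
Qed.

Theorem theorem5p3 (R : realType) (n : nat) (hn : (0 < n)%N) :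
  exists r : nat -> R,
    r =O_\oo (fun mu : nat => unit_roundoff R mu ^+ 2) /\
    forall (mu : nat) (fl : R -> R) (x : 'rV[R]_n),
      round_to_nearest mu fl ->
      (forall i, x 0 i <= x 0 (Ordinal hn)) ->
      let u := unit_roundoff R mu in
      let s := softmax x in
      let Omega := negligible_set u x (Ordinal hn) in
      forall k : 'I_n,
        `|fl_softmax fl x 0 k - s 0 k| <=
          ((n%:R - #|Omega|%:R + 2) * u + \sum_(i in Omega) s 0 i + r mu)
            * s 0 k.
Proof.
have C0 : 0 <= second_order_coef R n.
  rewrite /second_order_coef.
  have K0 : 0 <= 7 ^+ n.+2 :> R by rewrite exprn_ge0.
  have N0 : 0 <= n%:R :> R := ler0n R n.
  have L0 : 0 <= n%:R ^+ 3 :> R by rewrite exprn_ge0.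
  by rewrite !addr_ge0 // mulr_ge0 // !addr_ge0.
(* This remainder depends on [n] and [mu] only, so it serves every [fl] and [x]. *)
exists (fun mu => second_order_coef R n * unit_roundoff R mu ^+ 2); split.
  apply/eqO_exP; exists (second_order_coef R n + 1); first by rewrite ltr_wpDl.
  apply: nearW => mu; rewrite normrM (ger0_norm C0) ler_wpM2r //.
  by rewrite lerDl.
move=> mu fl x fl_nearest xmax u s Omega k.
have u0 : 0 < u := unit_roundoff_gt0 R mu.
have uh : u <= 2^-1 := unit_roundoff_le_half R mu.
have := fl_recursive_sum_softmax R n hn mu fl x fl_nearest.
rewrite /= -/u -/Omega.
rewrite /s /softmax /fl_softmax !mxE.
have -> : \sum_(i in Omega) (\row_i (expR (x 0 i) / \sum_j expR (x 0 j))) 0 i =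
    (\sum_(i in Omega) expR (x 0 i)) / \sum_j expR (x 0 j).
  by rewrite mulr_suml; apply: eq_bigr => i _; rewrite mxE.
set p := fl_recursive_sum _ _; set A := \sum_(i | i \notin Omega) _.
set E := \sum_j _; set B := \sum_(i in Omega) _.
have EAB : E = B + A by rewrite /E (bigID [in Omega]).
have e0 i : 0 < expR (x 0 i) by exact: expR_gt0.
set e1 := expR (x 0 (Ordinal hn)).
have e1A : e1 <= A.
  have n1 := notin_negligible_set R mu n x (Ordinal hn).
  by rewrite /A (bigD1 (Ordinal hn)) //= lerDl sumr_ge0 // => i _; apply: ltW.
have A0 : 0 < A := lt_le_trans (e0 _) e1A.
have B0 : 0 <= B by rewrite sumr_ge0 // => i _; apply: ltW.
have E0 : 0 < E by rewrite EAB; lra.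
have Ene1 : E <= n%:R * e1.
  rewrite -[n in n%:R](card_ord n) mulr_natl -sumr_const ler_sum // => i _.
  by rewrite ler_expR.
have Bne1 : B <= n%:R * (u * e1).
  apply: (@le_trans _ _ (\sum_(i in Omega) u * e1)).
    apply: ler_sum => i; rewrite inE expRD expRN -/e1 ltr_pdivrMr ?e0 // => lti.
    apply: le_trans (ltW lti) _; rewrite ler_pM2r ?e0 //.
    rewrite mulrA ler_pdivrMr; last lra.
    by nra.
  rewrite sumr_const -(mulr_natl (u * e1)) ler_wpM2r //.
    by rewrite mulr_ge0 ?ltW ?e0.
  by rewrite ler_nat -[leqRHS]card_ord max_card.
have cardO : n%:R - #|Omega|%:R = #|~: Omega|%:R :> R.
  by rewrite -{1}(card_ord n) -(cardsC Omega) natrD addrC addKr.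
rewrite cardO.
have mn : (#|~: Omega| <= n)%N by rewrite -[leqRHS]card_ord max_card.
move: #|~: Omega| mn => m mn /andP[p1 p2].
set sg := B / E.
have AE : A = E * (1 - sg).
  by rewrite mulrBr mulr1 /sg mulrCA divff ?gt_eqF // mulr1 EAB addrAC subrr
    add0r.
have sg0 : 0 <= sg by rewrite divr_ge0 // ltW.
have sgn : sg <= n%:R * u.
  rewrite ler_pdivrMr // (le_trans Bne1) // -mulrA ler_wpM2l // ler_pM2l //.
  by rewrite EAB; lra.
(* [1 - sg = A / E], with [A >= e1] because the maximal term is kept and [E <= n * e1] because it is
   maximal. *)
have ns : 1 <= n%:R * (1 - sg).
  rewrite -(ler_pM2r E0) mul1r -mulrA (mulrC _ E) -AE (le_trans Ene1) //.
  by rewrite ler_wpM2l.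
have uu : 0 <= u <= 2^-1 by rewrite ltW.
have := relative_error_second_order R n m u sg uu mn sg0 sgn ns.
set T := (X in X * _) => hT.
have W0 : 0 < (1 - u) ^+ m by rewrite exprn_gt0 //; lra.
have p0 : 0 < p by apply: lt_le_trans p1; rewrite mulr_gt0.
have /ler_normlP[y1 y2] :=
  round_to_nearest_relative R mu fl (expR (x 0 k)) fl_nearest (e0 k).
move: (expR (x 0 k)) (e0 k) y1 y2 => e ek y1 y2; rewrite -/u in y1 y2.
have y0 : 0 < fl e by nra.
have q0 : 0 < fl e / p by rewrite divr_gt0.
have /ler_normlP[q1 q2] :=
  round_to_nearest_relative R mu fl (fl e / p) fl_nearest q0.
rewrite -/u in q1 q2.
have qle : fl (fl e / p) <= T * (e / E).
  apply: (@le_trans _ _ ((1 + u) * (fl e / p))); first lra.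
  rewrite mulrA ler_pdivrMr //.
  apply: (@le_trans _ _ ((1 + u) ^+ 2 * e)).
    by rewrite expr2 -mulrA ler_wpM2l; lra.
  apply: (@le_trans _ _ (T * ((1 - u) ^+ m * (1 - sg)) * e)).
    by rewrite ler_wpM2r // ltW.
  have T0 : 0 <= T.
    have Cu0 : 0 <= second_order_coef R n * u ^+ 2.
      by rewrite mulr_ge0 // exprn_ge0 // ltW.
    have mu0 : 0 <= (m%:R + 2) * u by rewrite mulr_ge0 ?addr_ge0 // ltW.
    by rewrite /T; lra.
  have -> : T * ((1 - u) ^+ m * (1 - sg)) * e =
      T * (e / E) * ((1 - u) ^+ m * A).
    by rewrite AE; field; rewrite gt_eqF.
  by rewrite ler_wpM2l // mulr_ge0 // divr_ge0 ?ltW.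
(* Dropping terms only shrinks the denominator, so [sg] is absent here. As
   [(1 - u)^m (1 + u)^m <= 1], dividing by [p] costs at most a factor [(1 - u)^m]; Bernoulli's
   inequality then linearises [(1 - u)^(m + 2)]. *)
have qge : (1 - (m%:R + 2) * u) * (e / E) <= fl (fl e / p).
  apply: (@le_trans _ _ ((1 - u) * (fl e / p))); last lra.
  have bern : 1 - (m%:R + 2) * u <= (1 - u) ^+ m.+2.
    rewrite -natrD addn2; elim: m.+2 => [|j IHj]; first by rewrite expr0; lra.
    rewrite exprS -[j.+1%:R]natr1.
    have j0 : 0 <= j%:R :> R := ler0n R j.
    apply: (@le_trans _ _ ((1 - u) * (1 - j%:R * u))).
      have : 0 <= j%:R * u ^+ 2 by rewrite mulr_ge0 // exprn_ge0 // ltW.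
      lra.
    by rewrite ler_wpM2l //; lra.
  have pE : (1 - u) ^+ m * p <= E.
    apply: (@le_trans _ _ ((1 - u) ^+ m * ((1 + u) ^+ m * E))).
      rewrite ler_pM2l // (le_trans p2) // ler_wpM2l ?exprn_ge0 //; first lra.
      by rewrite EAB; lra.
    rewrite mulrA -exprMn ler_piMl ?(ltW E0) // exprn_ile1; nra.
  apply: (@le_trans _ _ ((1 - u) ^+ m.+2 * (e / E))).
    by rewrite ler_wpM2r // divr_ge0 ?ltW.
  have -> : (1 - u) * (fl e / p) = (1 - u) * fl e * E / p / E.
    by field; rewrite !gt_eqF.
  rewrite mulrA ler_pM2r ?invr_gt0 // ler_pdivlMr //.
  apply: (@le_trans _ _ ((1 - u) * ((1 - u) * e) * E)); last first.
    by rewrite ler_pM2r // ler_pM2l; lra.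
  have -> : (1 - u) ^+ m.+2 * e * p =
      (1 - u) * ((1 - u) * e) * ((1 - u) ^+ m * p).
    by rewrite !exprS; ring.
  by rewrite ler_wpM2l // !mulr_ge0 ?ltW //; lra.
have t0 : 0 <= e / E by rewrite divr_ge0 ?ltW.
have r0 : 0 <= (sg + second_order_coef R n * u ^+ 2) * (e / E).
  by rewrite mulr_ge0 // addr_ge0 // mulr_ge0 // exprn_ge0 // ltW.
rewrite ler_norml; apply/andP; split.
  by move: qge r0; move: (e / E) => t; lra.
by move: qle; rewrite /T; move: (e / E) => t; lra.
Qed.
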